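(* Let $\rho$ be non-real and let $H$ be a symmetric $4\times 4$ Hadamard matrix in dephased form with $\rho$ on the diagonal (i.e. $\rho$ is a diagonal entry of $2H$). Then the eigenvalues of $H$ (with multiplicity) are $\{1,1,-1,\rho\}$.
   Context: An $n\times n$ complex matrix $H$ is called a Hadamard matrix if it is unitary and all its entries have complex modulus $\frac{1}{\sqrt n}$. It is in dephased form if all entries of its first row and first column are equal to $\frac{1}{\sqrt n}$. Entries of $4\times 4$ Hadamard matrices are named without the scaling factor $\frac12$, so an entry called $\rho$ is the entry $\frac{\rho}{2}$ of $H$. Symmetric means $H^T=H$. *)

(* Defs.v *)
From HB Require Import structures.
From mathcomp Require Import all_boot all_order all_algebra.
From mathcomp Require Import sesquilinear spectral.
From mathcomp Require Import reals complex.

Set Implicit Arguments.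
Unset Strict Implicit.
Unset Printing Implicit Defensive.

Import Order.TTheory GRing.Theory Num.Theory.
Local Open Scope ring_scope.

(* Normalized convention: H itself is unitary (H H^* = 1), rather than
   H H^* = n with unimodular entries. *)
Definition hadamard (R : realType) (n : nat) (H : 'M[R[i]]_n) : Prop :=
  H \is unitarymx /\ forall i j : 'I_n, `|H i j| = 1 / sqrtC n%:R.

Definition dephased (R : realType) (n : nat) (H : 'M[R[i]]_n) : Prop :=
  forall i j : 'I_n, i = 0%N :> nat \/ j = 0%N :> nat ->
    H i j = 1 / sqrtC n%:R.

(* s lists the eigenvalues of A, each repeated according to its algebraic
   multiplicity; the order of s is irrelevant. *)
Definition eigenvalues_with_mult (R : realType) (n : nat) (A : 'M[R[i]]_n)
    (s : seq R[i]) : Prop :=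
  char_poly A = \prod_(z <- s) ('X - z%:P).

(* Main.v *)
Require Import Defs.
From HB Require Import structures.
From mathcomp Require Import all_boot all_order all_algebra.
From mathcomp Require Import sesquilinear spectral.
From mathcomp Require Import reals complex.
From mathcomp Require Import ring.

(** Put [A = 2H].  Four unimodular numbers [1, z, u, v] with sum [0] and [z]
    non-real satisfy [uv = z], hence [(1 + u)(1 + v) = 0].  Applied to the row
    of [A] containing [rho] on the diagonal, this makes one of the remaining
    entries [-1] and the other [-rho]; orthogonality of two rows of the core
    then gives [(1 - rho)(1 - y^* ) = 0] for the diagonal entry [y] in the
    column of the [-1], so [y = 1] and all of [A] is determined up to a
    simultaneous permutation of its last three rows and columns. *)

Set Implicit Arguments.
Unset Strict Implicit.
Unset Printing Implicit Defensive.

Import Order.TTheory GRing.Theory Num.Theory.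
Local Open Scope ring_scope.

(** Conjugation inverts unimodular numbers, so conjugating the sum and multiplying by [z * u * v]
    gives a second relation; subtracting [z] times the sum leaves [(1 + z) * (u * v - z) = 0]. *)
Lemma unimodular_sum4_eq0 (C : numClosedFieldType) (z u v : C) :
  `|z| = 1 -> `|u| = 1 -> `|v| = 1 -> z != -1 -> 1 + z + u + v = 0 ->
  (u = -1 /\ v = - z) \/ (v = -1 /\ u = - z).
Proof.
move=> z1 u1 v1 zN1 s0.
have zz : z * z^* = 1 by rewrite -normCK z1 expr1n.
have uu : u * u^* = 1 by rewrite -normCK u1 expr1n.
have vv : v * v^* = 1 by rewrite -normCK v1 expr1n.
have s0c : 1 + z^* + u^* + v^* = 0.
  by rewrite -(rmorph1 Num.conj) -!rmorphD s0 rmorph0.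
have vE : v = - (1 + z + u) by apply/eqP; rewrite -addr_eq0 addrC s0.
have : (1 + z) * (u * v - z) = 0.
  transitivity (z * u * v * (1 + z^* + u^* + v^*) - (z * z^* - 1) * (u * v)
    - (u * u^* - 1) * (z * v) - (v * v^* - 1) * (z * u)
    - z * (1 + z + u + v)); first by ring.
  by rewrite s0 s0c zz uu vv subrr !mul0r !mulr0 !subr0.
move/eqP; rewrite mulf_eq0 addrC addr_eq0 (negPf zN1) /= => /eqP uvz.
have : (1 + u) * (1 + v) = 0.
  transitivity ((1 + z + u + v) + (u * v - z)); first by ring.
  by rewrite s0 uvz addr0.
move/eqP; rewrite mulf_eq0 ![1 + _]addrC !addr_eq0 => /orP[] /eqP E.
  by left; split=> //; rewrite vE E; ring.
right; split=> //; apply/eqP; rewrite -addr_eq0 -s0 E; apply/eqP; ring.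
Qed.

(** The rows are [(1, a, d, e)], [(1, d, b, f)] and [(1, e, f, c)]. The second row sum gives
    [f = - b], which turns the orthogonality relation into [(1 - a) * (1 - b^* ) = 0]. *)
Lemma symmetric_core_of_offdiag (C : numClosedFieldType) (a b c d e f : C) :
  a != 1 -> d = -1 -> e = - a -> 1 + d + b + f = 0 -> 1 + e + f + c = 0 ->
  1 + a * d^* + d * b^* + e * f^* = 0 ->
  [/\ b = 1, f = -1 & c = a].
Proof.
move=> aN1 -> -> rb rc orth.
have fE : f = - b by apply/eqP; rewrite -addr_eq0 -rb; apply/eqP; ring.
have : (1 - a) * (1 - b^*) = 0.
  by rewrite -orth fE !rmorphN rmorph1; ring.
move/eqP; rewrite mulf_eq0 !subr_eq0 eq_sym (negPf aN1) /= eq_sym => /eqP bc.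
have b1 : b = 1 by rewrite -(conjCK b) bc rmorph1.
split=> //; first by rewrite fE b1.
by apply/eqP; rewrite -subr_eq0 -rc fE b1; apply/eqP; ring.
Qed.

Lemma symmetric_core (C : numClosedFieldType) (a b c d e f : C) :
  `|a| = 1 -> `|d| = 1 -> `|e| = 1 -> a \isn't Num.real ->
  1 + a + d + e = 0 -> 1 + d + b + f = 0 -> 1 + e + f + c = 0 ->
  1 + a * d^* + d * b^* + e * f^* = 0 ->
  1 + a * e^* + d * f^* + e * c^* = 0 ->
  [/\ b = 1, c = a, d = -1, e = - a & f = -1] \/
  [/\ b = a, c = 1, d = - a, e = -1 & f = -1].
Proof.
move=> a1 d1 e1 aNr ra rb rc ob oc.
have aN1 : a != 1 by apply: contraNneq aNr => ->; apply: rpred1.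
have aNN1 : a != -1 by apply: contraNneq aNr => ->; rewrite rpredN rpred1.
case: (unimodular_sum4_eq0 a1 d1 e1 aNN1 ra) => [[dE eE]|[eE dE]].
  by left; case: (symmetric_core_of_offdiag aN1 dE eE rb rc ob).
(* Exchanging the last two indices swaps [b] with [c] and [d] with [e], and fixes [a] and [f]. *)
right; case: (@symmetric_core_of_offdiag _ a c b e d f) => //.
- by rewrite addrAC.
- by rewrite addrAC.
- by rewrite addrAC.
Qed.

(* Indexing by [nat] instead of ['I_n] lets the expansion of a determinant of
   concrete size compute. *)
Fixpoint laplace_det (K : comNzRingType) (n : nat) (f : nat -> nat -> K) : K :=
  if n is m.+1 then
    \sum_(0 <= j < m.+1) f 0%N j *
      ((-1) ^+ j * laplace_det m (fun i k => f i.+1 (bump j k)))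
  else 1.

Lemma laplace_detE (K : comNzRingType) (n : nat) (f : nat -> nat -> K) :
  \det (\matrix_(i < n, j < n) f i j) = laplace_det n f.
Proof.
elim: n f => [|n IHn] f; first by rewrite det_mx00.
rewrite (expand_det_row _ 0) /= big_mkord; apply: eq_bigr => j _.
rewrite mxE /cofactor add0n -IHn; congr (_ * (_ * \det _)).
by apply/matrixP => i k; rewrite !mxE.
Qed.

Theorem proposition2 (R : realType) (rho : R[i]) (H : 'M[R[i]]_4)
    (rho_nonreal : rho \isn't Num.real)
    (H_hadamard : hadamard H)
    (H_symmetric : H^T = H)
    (H_dephased : dephased H)
    (rho_diag : exists i : 'I_4, (2 *: H) i i = rho) :
  eigenvalues_with_mult H [:: 1; 1; -1; rho].
Proof.
case: H_hadamard => /unitarymxP Hunit Hmod.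
have sqrt4 : sqrtC 4%:R = 2%:R :> R[i].
  by rewrite (natrM _ 2 2) -expr2 sqrCK ?ler0n.
have two_neq0 : 2 != 0 :> R[i] by rewrite pnatr_eq0.
(* The unscaled matrix, indexed by [nat] to match [laplace_det]. *)
pose a (i j : nat) : R[i] := 2 * H (inord i) (inord j).
have HE i j : H i j = 2^-1 * a i j by rewrite /a !inord_val mulKf.
have a_sym i j : a i j = a j i by rewrite /a -[in LHS]H_symmetric mxE.
have a_col0 i : a i 0%N = 1.
  rewrite /a H_dephased; first by rewrite sqrt4 mul1r divff.
  by right; rewrite inordK.
have a_norm i j : `|a i j| = 1.
  by rewrite normrM Hmod sqrt4 normr_nat mul1r divff.
clearbody a.
have a_orth i j : (i < 4)%N -> (j < 4)%N -> i != j ->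
    1 + a i 1%N * (a j 1%N)^* + a i 2%N * (a j 2%N)^* + a i 3%N * (a j 3%N)^*
    = 0.
  move=> i4 j4 neq_ij.
  have /matrixP/(_ (inord i) (inord j)) := Hunit.
  rewrite !mxE -val_eqE /= !inordK // (negPf neq_ij) mulr0n.
  rewrite !big_ord_recl big_ord0 !mxE !HE !inordK // ?lift0 //=.
  rewrite !a_col0 !rmorphM fmorphV rmorph_nat rmorph1 => orth.
  transitivity (2 * 2 * 0 : R[i]); last by rewrite !mulr0.
  by rewrite -{}orth; field.
(* By symmetry row 0 is constant 1, so orthogonality to it is a vanishing row sum. *)
have a_sum i : (0 < i < 4)%N -> 1 + a i 1%N + a i 2%N + a i 3%N = 0.
  case/andP=> i_gt0 i4; rewrite -[RHS](@a_orth i 0%N) ?gtn_eqF //.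
  by rewrite !(a_sym 0%N) !a_col0 rmorph1 !mulr1.
have s1 := a_sum 1%N isT; have s2 := a_sum 2%N isT; have s3 := a_sum 3%N isT.
have o12 := a_orth 1%N 2%N isT isT isT.
have o13 := a_orth 1%N 3%N isT isT isT.
(* Both orders of a pair are kept: conjugation falls on the second row, and the row containing [rho]
   has to come first. *)
have o21 := a_orth 2%N 1%N isT isT isT.
have o23 := a_orth 2%N 3%N isT isT isT.
have o31 := a_orth 3%N 1%N isT isT isT.
have o32 := a_orth 3%N 2%N isT isT isT.
move: s1 s2 s3 o12 o13 o21 o23 o31 o32.
rewrite (a_sym 2%N 1%N) (a_sym 3%N 1%N) (a_sym 3%N 2%N).
move=> s1 s2 s3 o12 o13 o21 o23 o31 o32.
(* The three cores differ by the position of the diagonal entry 1; [- rho] links the other two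
   indices. The factorization is an identity in ['X], [x] and [t], valid for indeterminate [x];
   [2 * x = 1] enters only afterwards, through [twoK]. *)
have charE (x := 2^-1%:P : {poly R[i]}) (t := rho%:P) :
    [\/ [/\ a 1%N 1%N = rho, a 2%N 2%N = 1, a 3%N 3%N = rho &
          [/\ a 1%N 2%N = -1, a 1%N 3%N = - rho & a 2%N 3%N = -1]],
        [/\ a 1%N 1%N = rho, a 2%N 2%N = rho, a 3%N 3%N = 1 &
          [/\ a 1%N 2%N = - rho, a 1%N 3%N = -1 & a 2%N 3%N = -1]] |
        [/\ a 1%N 1%N = 1, a 2%N 2%N = rho, a 3%N 3%N = rho &
          [/\ a 1%N 2%N = -1, a 1%N 3%N = -1 & a 2%N 3%N = - rho]]] ->
    char_poly H
    = ('X - 2 * x) * (('X - 2 * x) * (('X + 2 * x) * ('X - 2 * x * t))).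
  have -> : char_poly H
      = laplace_det 4 (fun i j => 'X *+ (i == j) - (2^-1 * a i j)%:P).
    rewrite -laplace_detE; congr (\det _).
    by apply/matrixP => i j; rewrite !mxE HE.
  rewrite /= unlock /= /bump /=.
  rewrite !(a_sym 0%N) !a_col0.
  rewrite (a_sym 2%N 1%N) (a_sym 3%N 1%N) (a_sym 3%N 2%N) !polyCM.
  rewrite -/x.
  case=> -[-> -> -> [-> -> ->]]; rewrite ?polyCN -/t; ring.
have twoK : 2 * 2^-1%:P = 1 :> {poly R[i]}.
  by rewrite -polyC_natr -polyCM divff.
rewrite /eigenvalues_with_mult !big_cons big_nil mulr1 polyCN opprK.
rewrite charE ?twoK ?mul1r //.
move: rho_nonreal; case: rho_diag => k; rewrite mxE HE mulVKf // => <-.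
(* Split on the position of [rho]; position 0 is excluded because that entry is 1, hence real. *)
case: k => -[|[|[|[|//]]]] _ /= aNr {charE}.
- by rewrite a_col0 rpred1 in aNr.
- case: (@symmetric_core _ (a 1 1) (a 2 2) (a 3 3) (a 1 2) (a 1 3) (a 2 3))%N
    => // -[-> -> -> -> ->].
  + by constructor 1.
  + by constructor 2.
(* The indices are taken in the order 2, 1, 3, so that the row with [rho] on the diagonal leads; the
   last case uses 3, 1, 2. *)
- case: (@symmetric_core _ (a 2 2) (a 1 1) (a 3 3) (a 1 2) (a 2 3) (a 1 3))%N
    => //.
  + by rewrite -[RHS]s2; ring.
  + by rewrite -[RHS]s1; ring.
  + by rewrite -[RHS]s3; ring.
  + by rewrite -[RHS]o21; ring.
  + by rewrite -[RHS]o23; ring.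
  + by case=> -> -> -> -> ->; constructor 3.
  + by case=> -> -> -> -> ->; constructor 2.
- case: (@symmetric_core _ (a 3 3) (a 1 1) (a 2 2) (a 1 3) (a 2 3) (a 1 2))%N
    => //.
  + by rewrite -[RHS]s3; ring.
  + by rewrite -[RHS]s1; ring.
  + by rewrite -[RHS]s2; ring.
  + by rewrite -[RHS]o31; ring.
  + by rewrite -[RHS]o32; ring.
  + by case=> -> -> -> -> ->; constructor 3.
  + by case=> -> -> -> -> ->; constructor 1.
Qed.
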